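(* Let $\mathcal{M}$ be a strict braided monoidal category, let $\mathcal{M}^p$ be the strict braided pivotal category of pivotal objects in $\mathcal{M}$, and let $\mathcal{M}^r$ be the full subcategory of $\mathcal{M}^p$ whose objects are the ribbon objects in $\mathcal{M}$. Then $\mathcal{M}^r$ is a strict braided pivotal subcategory of $\mathcal{M}^p$ and a strict ribbon category.
   Context: An object also denotes its identity morphism; juxtaposition of morphisms is composition; $I$ is the unit object. A duality in a strict monoidal category is a quadruple $(X,X^*,d_X,b_X)$ with $d_X:X^*\otimes X\to I$, $b_X:I\to X\otimes X^*$ such that $(X\otimes d_X)(b_X\otimes X)=\mathrm{id}_X$ and $(d_X\otimes X^* )(X^*\otimes b_X)=\mathrm{id}_{X^*}$; $(X^*,d_X,b_X)$ is then a left dual of $X$. The left dual of $f:X\to Y$ is $f^*=(d_Y\otimes X^* )(Y^*\otimes f\otimes X^* )(Y^*\otimes b_X):Y^*\to X^*$. A pivotal object in $\mathcal{M}$ is a sextuple $X^p=(X,X^*,d_X,b_X,d_{X^*},b_{X^*})$ such that both $(X,X^*,d_X,b_X)$ and $(X^*,X,d_{X^*},b_{X^*})$ are dualities in $\mathcal{M}$. A morphism $f:X^p\to Y^p$ is a morphism $f:X\to Y$ in $\mathcal{M}$ with $f=f^{**}$, where $f^{**}=(d_{X^*}\otimes Y)(X\otimes f^*\otimes Y)(X\otimes b_{Y^*})$. The resulting category $\mathcal{M}^p$ has the following strict braided pivotal structure: unit $I^p=(I,I,\mathrm{id}_I,\mathrm{id}_I,\mathrm{id}_I,\mathrm{id}_I)$;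 tensor product $X^p\otimes Y^p=(X\otimes Y,Y^*\otimes X^*,d_{X\otimes Y},b_{X\otimes Y},d_{Y^*\otimes X^*},b_{Y^*\otimes X^*})$ with $d_{X\otimes Y}=d_Y(Y^*\otimes d_X\otimes Y)$, $b_{X\otimes Y}=(X\otimes b_Y\otimes X^* )b_X$, $d_{Y^*\otimes X^*}=d_{X^*}(X\otimes d_{Y^*}\otimes X^* )$, $b_{Y^*\otimes X^*}=(Y^*\otimes b_{X^*}\otimes Y)b_{Y^*}$; tensor product of morphisms as in $\mathcal{M}$; left dual $(X^p)^*=(X^*,X,d_{X^*},b_{X^*},d_X,b_X)$ with evaluation $d_X$ and coevaluation $b_X$; braiding $\psi_{X^p,Y^p}=\psi_{X,Y}$, the braiding of $\mathcal{M}$. For a pivotal object $X^p$ in $\mathcal{M}$, the right and left positive curls are the morphisms $X\to X$ given by $$c^R_X=(X\otimes d_{X^*})(\psi_{X,X}\otimes X^* )(X\otimes b_X),\qquad c^L_X=(d_X\otimes X)(X^*\otimes\psi_{X,X})(b_{X^*}\otimes X).$$ A ribbon object in $\mathcal{M}$ is a pivotal object $X^p$ with $c^R_X=c^L_X$. A strict pivotal category is a strict monoidal category $\mathcal{N}$ with chosen left duals such that $(-)^*:\mathcal{N}^{\mathrm{op}}\to\mathcal{N}$ is a strict monoidal functor (where $\mathcal{N}^{\mathrm{op}}$ has the reversed tensor product), $d_I=b_I=\mathrm{id}_I$, $d_{X\otimes Y}=d_Y(Y^*\otimes d_X\otimes Y)$, $b_{X\otimes Y}=(X\otimes b_Y\otimes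 X^* )b_X$, and $(-)^{**}=\mathrm{Id}_{\mathcal{N}}$. A strict braided pivotal category is a strict pivotal category equipped with a braiding, i.e. natural isomorphisms $\psi_{X,Y}:X\otimes Y\to Y\otimes X$ with $\psi_{X\otimes Y,Z}=(\psi_{X,Z}\otimes Y)(X\otimes\psi_{Y,Z})$ and $\psi_{X,Y\otimes Z}=(Y\otimes\psi_{X,Z})(\psi_{X,Y}\otimes Z)$. In such a category every object $X$ has right and left positive curls $c^R_X,c^L_X:X\to X$ given by $c^R_X=(X\otimes d_{X^*})(\psi_{X,X}\otimes X^* )(X\otimes b_X)$ and $c^L_X=(d_X\otimes X)(X^*\otimes\psi_{X,X})(b_{X^*}\otimes X)$, using the chosen duals of $X$ and $X^*$. A strict ribbon category is a strict braided pivotal category in which $c^R_X=c^L_X$ for every object $X$. That a full subcategory of $\mathcal{M}^p$ is a strict braided pivotal subcategory means that it contains the unit object and is closed under tensor products and duals, with the structure restricted from $\mathcal{M}^p$. *)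

(* Defs.v *)
From mathcomp Require Import ssreflect ssrfun.
From Stdlib Require Import ProofIrrelevance PropExtensionality.
From Stdlib Require Import FunctionalExtensionality.

Set Implicit Arguments.
Unset Strict Implicit.
Unset Printing Implicit Defensive.

Declare Scope ob_scope.
Delimit Scope ob_scope with ob.
Declare Scope hom_scope.
Delimit Scope hom_scope with hom.
Local Open Scope hom_scope.

(* In a strict monoidal category the associativity and unit laws on objects
   are propositional equalities, so the two sides of a law between morphisms
   need not have convertible types.  [f ≡ g] states that f and g have the same
   source and the same target and are equal as morphisms. *)
Inductive heq (ob : Type) (hom : ob -> ob -> Type) (X Y : ob) (f : hom X Y) :
  forall X' Y' : ob, hom X' Y' -> Prop := heq_refl : heq f f.
Notation "f ≡ g" := (heq f g) (at level 70, no associativity) : type_scope.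

Record strict_moncat := StrictMoncat {
  ob :> Type;
  hom : ob -> ob -> Type;
  idm : forall X, hom X X;
  comp : forall X Y Z, hom Y Z -> hom X Y -> hom X Z;
  unit : ob;
  tens : ob -> ob -> ob;
  tensm : forall X Y X' Y', hom X Y -> hom X' Y' -> hom (tens X X') (tens Y Y');
  compA : forall X Y Z T (h : hom Z T) (g : hom Y Z) (f : hom X Y),
    comp h (comp g f) = comp (comp h g) f;
  comp1m : forall X Y (f : hom X Y), comp (idm Y) f = f;
  compm1 : forall X Y (f : hom X Y), comp f (idm X) = f;
  tensm_id : forall X Y, tensm (idm X) (idm Y) = idm (tens X Y);
  tensm_comp : forall X Y Z X' Y' Z' (g : hom Y Z) (f : hom X Y)
      (g' : hom Y' Z') (f' : hom X' Y'),
    tensm (comp g f) (comp g' f') = comp (tensm g g') (tensm f f');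
  tensA : forall X Y Z, tens X (tens Y Z) = tens (tens X Y) Z;
  tens1o : forall X, tens unit X = X;
  tenso1 : forall X, tens X unit = X;
  tensmA : forall X Y X' Y' X'' Y''
      (f : hom X Y) (g : hom X' Y') (h : hom X'' Y''),
    tensm f (tensm g h) ≡ tensm (tensm f g) h;
  tens1m : forall X Y (f : hom X Y), tensm (idm unit) f ≡ f;
  tensm1 : forall X Y (f : hom X Y), tensm f (idm unit) ≡ f
}.

Bind Scope ob_scope with ob.
Bind Scope hom_scope with hom.
Arguments hom {M} (X Y)%_ob : rename.
Arguments idm {M} X%_ob : rename.
Arguments comp {M X Y Z} (g f)%_hom : rename.
Arguments unit {M} : rename.
Arguments tens {M} (X Y)%_ob : rename.
Arguments tensm {M X Y X' Y'} (f g)%_hom : rename.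

Notation "𝟙" := unit : ob_scope.
Notation "X ⊗ Y" := (tens X Y) (at level 40, left associativity) : ob_scope.
Notation "f ⊗ g" := (tensm f g) : hom_scope.

Definition castm (M : strict_moncat) (X Y X' Y' : M) (f : hom X Y)
    (eX : X = X') (eY : Y = Y') : hom X' Y' :=
  match eX in _ = A, eY in _ = B return hom A B with
  | eq_refl, eq_refl => f
  end.
Arguments castm {M X Y X' Y'} & f eX eY : simpl never.

Definition compc (M : strict_moncat) (X Y Y' Z : M) (g : hom Y' Z) (f : hom X Y)
    (e : Y = Y') : hom X Z := comp g (castm f eq_refl e).
Arguments compc {M X Y Y' Z} g f e : simpl never.

(* [g ∘ f] composes morphisms whose middle objects agree up to the strict
   monoidal laws, and [⟦ f ⟧] transports f to the expected type along such
   equalities; the equations between objects are solved by rewriting. *)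
#[global] Hint Rewrite tensA tens1o tenso1 : obj.
Ltac ob_eq := autorewrite with obj; reflexivity.
Notation "g ∘ f" := (compc g f ltac:(ob_eq))
  (at level 50, left associativity, only parsing) : hom_scope.
Notation "⟦ f ⟧" := (castm f ltac:(ob_eq) ltac:(ob_eq))
  (at level 0, only parsing) : hom_scope.

Record braiding (M : strict_moncat) := Braiding {
  psi : forall X Y : M, hom (X ⊗ Y) (Y ⊗ X);
  psi_iso : forall X Y, exists phi : hom (Y ⊗ X) (X ⊗ Y),
    comp phi (psi X Y) = idm (X ⊗ Y) /\ comp (psi X Y) phi = idm (Y ⊗ X);
  psi_nat : forall X Y X' Y' (f : hom X Y) (g : hom X' Y'),
    comp (psi Y Y') (f ⊗ g) = comp (g ⊗ f) (psi X X');
  psi_tensl : forall X Y Z,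
    psi (X ⊗ Y) Z ≡ (psi X Z ⊗ idm Y) ∘ (idm X ⊗ psi Y Z);
  psi_tensr : forall X Y Z,
    psi X (Y ⊗ Z) ≡ (idm Y ⊗ psi X Z) ∘ (psi X Y ⊗ idm Z)
}.

Record strict_braided_moncat := StrictBraidedMoncat {
  braided_moncat :> strict_moncat;
  braiding_of : braiding braided_moncat
}.

Definition duality (M : strict_moncat) (X Xs : M)
    (d : hom (Xs ⊗ X) 𝟙) (b : hom 𝟙 (X ⊗ Xs)) : Prop :=
  (idm X ⊗ d) ∘ (b ⊗ idm X) ≡ idm X /\ (d ⊗ idm Xs) ∘ (idm Xs ⊗ b) ≡ idm Xs.

Definition ldual (M : strict_moncat) (X Xs Y Ys : M) (bX : hom 𝟙 (X ⊗ Xs))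
    (dY : hom (Ys ⊗ Y) 𝟙) (f : hom X Y) : hom Ys Xs :=
  ⟦ (dY ⊗ idm Xs) ∘ (idm Ys ⊗ f ⊗ idm Xs) ∘ (idm Ys ⊗ bX) ⟧.

Definition tens_ev (M : strict_moncat) (X Xs Y Ys : M)
    (dX : hom (Xs ⊗ X) 𝟙) (dY : hom (Ys ⊗ Y) 𝟙) :
    hom ((Ys ⊗ Xs) ⊗ (X ⊗ Y)) 𝟙 :=
  ⟦ dY ∘ (idm Ys ⊗ dX ⊗ idm Y) ⟧.

Definition tens_coev (M : strict_moncat) (X Xs Y Ys : M)
    (bX : hom 𝟙 (X ⊗ Xs)) (bY : hom 𝟙 (Y ⊗ Ys)) :
    hom 𝟙 ((X ⊗ Y) ⊗ (Ys ⊗ Xs)) :=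
  ⟦ (idm X ⊗ bY ⊗ idm Xs) ∘ bX ⟧.

Record left_duals (N : strict_moncat) := LeftDuals {
  dual : N -> N;
  ev : forall X, hom (dual X ⊗ X) 𝟙;
  coev : forall X, hom 𝟙 (X ⊗ dual X);
  ev_coev_duality : forall X, duality (ev X) (coev X)
}.

Definition dualm (N : strict_moncat) (D : left_duals N) (X Y : N)
    (f : hom X Y) : hom (dual D Y) (dual D X) := ldual (coev D X) (ev D Y) f.

Record strict_pivotal (N : strict_moncat) (D : left_duals N) : Prop :=
  StrictPivotal {
  dualm_id : forall X, dualm D (idm X) = idm (dual D X);
  dualm_comp : forall X Y Z (g : hom Y Z) (f : hom X Y),
    dualm D (comp g f) = comp (dualm D f) (dualm D g);
  dual_unit : dual D 𝟙 = 𝟙%ob;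
  dual_tens : forall X Y, dual D (X ⊗ Y) = (dual D Y ⊗ dual D X)%ob;
  dualm_tens : forall X Y X' Y' (f : hom X Y) (g : hom X' Y'),
    dualm D (f ⊗ g) ≡ dualm D g ⊗ dualm D f;
  ev_unit : ev D 𝟙 ≡ idm (M := N) 𝟙;
  coev_unit : coev D 𝟙 ≡ idm (M := N) 𝟙;
  ev_tens : forall X Y, ev D (X ⊗ Y) ≡ tens_ev (ev D X) (ev D Y);
  coev_tens : forall X Y, coev D (X ⊗ Y) ≡ tens_coev (coev D X) (coev D Y);
  dualK : forall X, dual D (dual D X) = X;
  dualmK : forall X Y (f : hom X Y), dualm D (dualm D f) ≡ f
}.

Record strict_braided_pivcat := StrictBraidedPivcat {
  pivcat_braided :> strict_braided_moncat;
  duals_of : left_duals pivcat_braided;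
  pivotal_of : strict_pivotal duals_of
}.

Definition curlR (M : strict_braided_moncat) (X Xs : M) (ds : hom (X ⊗ Xs) 𝟙)
    (b : hom 𝟙 (X ⊗ Xs)) : hom X X :=
  ⟦ (idm X ⊗ ds) ∘ (psi (braiding_of M) X X ⊗ idm Xs) ∘ (idm X ⊗ b) ⟧.

Definition curlL (M : strict_braided_moncat) (X Xs : M) (d : hom (Xs ⊗ X) 𝟙)
    (bs : hom 𝟙 (Xs ⊗ X)) : hom X X :=
  ⟦ (d ⊗ idm X) ∘ (idm Xs ⊗ psi (braiding_of M) X X) ∘ (bs ⊗ idm X) ⟧.

Lemma dual_ofK (N : strict_braided_pivcat) (X : N) :
  dual (duals_of N) (dual (duals_of N) X) = X.
Proof. exact: dualK (pivotal_of N) X. Qed.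
#[global] Hint Rewrite dual_ofK : obj.

Definition strict_ribbon (N : strict_braided_pivcat) : Prop :=
  forall X : N,
    let D := duals_of N in
    curlR ⟦ ev D (dual D X) ⟧ (coev D X) =
    curlL (ev D X) ⟦ coev D (dual D X) ⟧.

(* The components of the sextuple are X, X^*, d_X, b_X, d_{X^*}, b_{X^*}. *)
Record pivotal_object (M : strict_moncat) := PivotalObject {
  po : M;
  pos : M;
  pd : hom (pos ⊗ po) 𝟙;
  pb : hom 𝟙 (po ⊗ pos);
  pds : hom (po ⊗ pos) 𝟙;
  pbs : hom 𝟙 (pos ⊗ po);
  pd_pb_duality : duality pd pb;
  pds_pbs_duality : duality pds pbs
}.
Arguments pd {M} p.
Arguments pb {M} p.
Arguments pds {M} p.
Arguments pbs {M} p.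

Definition pstar (M : strict_moncat) (X Y : pivotal_object M)
    (f : hom (po X) (po Y)) : hom (pos Y) (pos X) := ldual (pb X) (pd Y) f.

Definition pstarstar (M : strict_moncat) (X Y : pivotal_object M)
    (f : hom (po X) (po Y)) : hom (po X) (po Y) := ldual (pbs Y) (pds X) (pstar f).

Definition pivotal_hom (M : strict_moncat) (X Y : pivotal_object M) : Type :=
  {f : hom (po X) (po Y) | f = pstarstar f}.

Definition ribbon_object (M : strict_braided_moncat)
    (X : pivotal_object M) : Prop :=
  curlR (pds X) (pb X) = curlL (pd X) (pbs X).

(* A calculus of strict morphisms without transports. An [arr] is a set of
   morphisms with a common source and target; composition and tensor product
   are total operations on such sets, and a morphism embeds as a singleton. *)
Section Arrows.
Variable M : strict_moncat.
Implicit Types X Y Z : M.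

Lemma heq_eq X Y (f g : hom X Y) : f ≡ g -> f = g.
Proof.
move=> e; suff H : existT (fun X => {Y & hom X Y}) X (existT _ Y f) =
                   existT _ X (existT _ Y g).
  exact: inj_pair2 (inj_pair2 _ _ _ _ _ H).
by destruct e.
Qed.

Record arr := Arr { dom : M; cod : M; val : hom dom cod -> Prop }.

Definition sing X Y (f : hom X Y) : arr := @Arr X Y (eq f).
Definition aid X : arr := sing (idm X).
Definition acomp (g f : arr) : arr :=
  @Arr (dom f) (cod g) (fun h => exists (u : hom (dom f) (cod f))
    (v : hom (dom g) (cod g)) (e : cod f = dom g),
    val u /\ val v /\ h = compc v u e).
Definition atens (f g : arr) : arr :=
  @Arr (dom f ⊗ dom g) (cod f ⊗ cod g) (fun h =>
    exists (u : hom (dom f) (cod f)) (v : hom (dom g) (cod g)),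
    val u /\ val v /\ h = tensm u v).

Lemma arr_ext (f g : arr) : dom f = dom g -> cod f = cod g ->
  (forall u, @val f u -> exists2 v, @val g v & u ≡ v) ->
  (forall v, @val g v -> exists2 u, @val f u & v ≡ u) -> f = g.
Proof.
case: f g => [X Y P] [X' Y' Q] /= eX eY; case: X' / eX Q; case: Y' / eY => Q.
move=> PQ QP; congr Arr; apply: functional_extensionality => u.
apply: propositional_extensionality; split.
  by move=> /PQ [v Qv /heq_eq ->].
by move=> /QP [v Qv /heq_eq ->].
Qed.

Lemma heq_sing X Y X' Y' (f : hom X Y) (g : hom X' Y') :
  f ≡ g <-> sing f = sing g.
Proof.
split; first by move=> e; destruct e.
move=> e; have H A : A = sing f -> forall h, @val A h -> f ≡ h.
  by move=> -> h /= <-.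
exact: (H _ (eq_sym e) g eq_refl).
Qed.

Lemma sing_inj X Y (f g : hom X Y) : sing f = sing g -> f = g.
Proof. by move=> /heq_sing /heq_eq. Qed.

Lemma sing_cast X Y X' Y' (f : hom X Y) (eX : X = X') (eY : Y = Y') :
  sing (castm f eX eY) = sing f.
Proof. by case: X' / eX; case: Y' / eY. Qed.

Lemma sing_id X : sing (idm X) = aid X. Proof. by []. Qed.

Lemma sing_compc X Y Y' Z (g : hom Y' Z) (f : hom X Y) (e : Y = Y') :
  sing (compc g f e) = acomp (sing g) (sing f).
Proof.
apply: arr_ext => //= h.
  by move=> <-; exists (compc g f e) => //; exists f, g, e.
move=> [u [v [e' [<- [<- ->]]]]]; exists (compc g f e) => //.
by rewrite (UIP _ _ _ e e').
Qed.

Lemma sing_comp X Y Z (g : hom Y Z) (f : hom X Y) :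
  sing (comp g f) = acomp (sing g) (sing f).
Proof. by rewrite -(sing_compc _ _ eq_refl). Qed.

Lemma sing_tens X Y X' Y' (f : hom X Y) (g : hom X' Y') :
  sing (tensm f g) = atens (sing f) (sing g).
Proof.
apply: arr_ext => //= h.
  by move=> <-; exists (tensm f g) => //; exists f, g.
by move=> [u [v [<- [<- ->]]]]; exists (tensm f g).
Qed.

Lemma heq_sym X Y X' Y' (f : hom X Y) (g : hom X' Y') : f ≡ g -> g ≡ f.
Proof. by move=> e; destruct e. Qed.

Lemma acompA h g f : acomp h (acomp g f) = acomp (acomp h g) f.
Proof.
case: f g h => [X X' P] [Y Y' Q] [Z Z' R].
apply: arr_ext => //= u.
  move=> [_ [w [/= e2 [[p [q [e1 [Pp [Qq ->]]]]] [Rw ->]]]]].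
  case: Y / e1 Q q Qq => Q q Qq; case: Z / e2 R w Rw => R w Rw.
  exists (comp (comp w q) p); last by rewrite /compc /= compA.
  exists p, (comp w q), eq_refl; split=> //; split=> //.
  by exists q, w, eq_refl.
move=> [p [_ [/= e1 [Pp [[q [w [e2 [Qq [Rw ->]]]]] ->]]]]].
case: Y / e1 Q q Qq => Q q Qq; case: Z / e2 R w Rw => R w Rw.
exists (comp w (comp q p)); last by rewrite /compc /= compA.
exists (comp q p), w, eq_refl; split=> //.
by exists p, q, eq_refl.
Qed.

Lemma acomp1 X f : X = cod f -> acomp (aid X) f = f.
Proof.
move=> ->; apply: arr_ext => //= h.
  move=> [u [v [e [Pu [<- ->]]]]]; exists u => //.
  by rewrite /compc (UIP_refl _ _ e) comp1m.
by move=> Ph; exists h => //; exists h, (idm _), eq_refl; rewrite /compc comp1m.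
Qed.

Lemma a1comp X f : X = dom f -> acomp f (aid X) = f.
Proof.
move=> ->; apply: arr_ext => //= h.
  move=> [u [v [e [<- [Pv ->]]]]]; exists v => //.
  by rewrite /compc (UIP_refl _ _ e) compm1.
by move=> Ph; exists h => //; exists (idm _), h, eq_refl; rewrite /compc compm1.
Qed.

Lemma atensA f g h : atens f (atens g h) = atens (atens f g) h.
Proof.
apply: arr_ext; rewrite /= ?tensA // => u.
  move=> [p [_ [Pp [[q [r [Pq [Pr ->]]]] ->]]]].
  exists (tensm (tensm p q) r); last exact: tensmA.
  by exists (tensm p q), r; split=> //; exists p, q.
move=> [_ [r [[p [q [Pp [Pq ->]]]] [Pr ->]]]].
exists (tensm p (tensm q r)); last exact/heq_sym/tensmA.
by exists p, (tensm q r); split=> //; split=> //; exists q, r.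
Qed.

Lemma a1tens f : atens (aid 𝟙) f = f.
Proof.
apply: arr_ext; rewrite /= ?tens1o // => u.
  by move=> [_ [v [<- [Pv ->]]]]; exists v => //; apply: tens1m.
move=> Pu; exists (tensm (idm 𝟙) u); last exact/heq_sym/tens1m.
by exists (idm 𝟙), u.
Qed.

Lemma atens1 f : atens f (aid 𝟙) = f.
Proof.
apply: arr_ext; rewrite /= ?tenso1 // => u.
  by move=> [v [_ [Pv [<- ->]]]]; exists v => //; apply: tensm1.
move=> Pu; exists (tensm u (idm 𝟙)); last exact/heq_sym/tensm1.
by exists u, (idm 𝟙).
Qed.

Lemma atens_id X Y : atens (aid X) (aid Y) = aid (X ⊗ Y).
Proof. by rewrite /aid -sing_tens tensm_id. Qed.

Lemma atens_comp f g f' g' : cod f = dom g -> cod f' = dom g' ->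
  acomp (atens g g') (atens f f') = atens (acomp g f) (acomp g' f').
Proof.
case: f g f' g' => [X Y P] [Y1 Z Q] [X' Y' P'] [Y1' Z' Q'] /= e e'.
case: Y1 / e Q => Q; case: Y1' / e' Q' => Q'.
apply: arr_ext => //= h.
  move=> [_ [_ [e [[p [p' [Pp [Pp' ->]]]] [[q [q' [Qq [Qq' ->]]]] ->]]]]].
  exists (tensm (comp q p) (comp q' p')).
    exists (comp q p), (comp q' p'); split; last split=> //.
      by exists p, q, eq_refl.
    by exists p', q', eq_refl.
  by rewrite tensm_comp /compc (UIP_refl _ _ e).
move=> [_ [_ [[p [q [e [Pp [Qq ->]]]]] [[p' [q' [e' [Pp' [Qq' ->]]]]] ->]]]].
exists (comp (tensm q q') (tensm p p')).
  exists (tensm p p'), (tensm q q'), eq_refl.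
  by split; [exists p, p'|split=> //; exists q, q'].
by rewrite /compc (UIP_refl _ _ e) (UIP_refl _ _ e') tensm_comp.
Qed.

End Arrows.

Notation "g ⊙ f" := (acomp g f) (at level 50, left associativity).
Notation "f ⊠ g" := (atens f g) (at level 40, left associativity).
Coercion sing : hom >-> arr.
Coercion aid : ob >-> arr.

Section Diagrams.
Variable M : strict_moncat.
Implicit Types (X Y Z A B C : M) (f g h : arr M).

Lemma atens_idr f A B : f ⊠ A ⊠ B = f ⊠ (A ⊗ B)%ob.
Proof. by rewrite -atensA atens_id. Qed.

Lemma atens_compl A f g : cod f = dom g -> A ⊠ (g ⊙ f) = (A ⊠ g) ⊙ (A ⊠ f).
Proof. by move=> e; rewrite atens_comp // acomp1. Qed.

Lemma atens_compr A f g : cod f = dom g -> (g ⊙ f) ⊠ A = (g ⊠ A) ⊙ (f ⊠ A).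
Proof. by move=> e; rewrite atens_comp // acomp1. Qed.

Lemma exch f g : (f ⊠ cod g) ⊙ (dom f ⊠ g) = (cod f ⊠ g) ⊙ (f ⊠ dom g).
Proof. by rewrite !atens_comp // !acomp1 // !a1comp. Qed.

Lemma atensE f g : f ⊠ g = (f ⊠ cod g) ⊙ (dom f ⊠ g).
Proof. by rewrite atens_comp // acomp1 // a1comp. Qed.

Lemma atensE' f g : f ⊠ g = (cod f ⊠ g) ⊙ (f ⊠ dom g).
Proof. by rewrite -exch -atensE. Qed.

Definition anorm := (@atensA M, @atens_id M, atens_idr, @a1tens M, @atens1 M,
  @tensA M, @tens1o M, @tenso1 M).

End Diagrams.

Ltac anorm := rewrite /= ?anorm.
Ltac aside := by rewrite /= ?(tensA, tens1o, tenso1).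
Ltac adistr := repeat
  (rewrite atens_compl; [|aside] || (rewrite atens_compr; [|aside])).


Ltac awhisk A H B :=
  have := f_equal (fun f => aid A ⊠ f ⊠ aid B) H; adistr; anorm.

Section Mates.
Variable M : strict_moncat.
Implicit Types X Y Z : M.

Lemma dualityP X Xs (d : hom (Xs ⊗ X) 𝟙) (b : hom 𝟙 (X ⊗ Xs)) :
  duality d b <-> (X ⊠ d) ⊙ (b ⊠ X) = X /\ (d ⊠ Xs) ⊙ (Xs ⊠ b) = Xs.
Proof. by rewrite /duality !heq_sing !sing_compc !sing_tens. Qed.

Lemma duality_tens X Xs Y Ys (dX : hom (Xs ⊗ X) 𝟙) (bX : hom 𝟙 (X ⊗ Xs))
    (dY : hom (Ys ⊗ Y) 𝟙) (bY : hom 𝟙 (Y ⊗ Ys)) :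
  duality dX bX -> duality dY bY ->
  duality (tens_ev dX dY) (tens_coev bX bY).
Proof.
rewrite !dualityP !sing_cast !sing_compc !sing_tens !sing_id.
move=> -[sX1 sX2] [sY1 sY2]; split.
  have := exch (X ⊠ bY) (dX ⊠ Y); anorm => E.
  adistr; anorm; rewrite acompA -(acompA (aid (X ⊗ Y) ⊠ dY)) -E.
  awhisk X sY1 (@unit M) => F; rewrite acompA F -acompA.
  by awhisk (@unit M) sX1 Y => G; rewrite G acomp1 //=.
have := exch (Ys ⊠ dX) (bY ⊠ Xs); anorm => E.
adistr; anorm; rewrite acompA -(acompA (dY ⊠ aid (Ys ⊗ Xs))) E.
awhisk (@unit M) sY2 Xs => F; rewrite acompA F -acompA.
by awhisk Ys sX2 (@unit M) => G; rewrite G acomp1 //=.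
Qed.

Lemma duality1 : @duality M 𝟙 𝟙 ⟦ idm (M := M) 𝟙 ⟧ ⟦ idm (M := M) 𝟙 ⟧.
Proof.
by rewrite dualityP !sing_cast !sing_id !atens_id !acomp1 //=; anorm.
Qed.

Lemma sing_ldual X Xs Y Ys (bX : hom 𝟙 (X ⊗ Xs)) (dY : hom (Ys ⊗ Y) 𝟙)
    (f : hom X Y) :
  sing (ldual bX dY f) = (dY ⊠ Xs) ⊙ ((Ys ⊠ f ⊠ Xs) ⊙ (Ys ⊠ bX)).
Proof. by rewrite sing_cast !sing_compc !sing_tens acompA. Qed.

(* A morphism g : Ys -> Xs is the left dual of f : X -> Y exactly when the two
   evaluations agree. *)
Lemma ldual_mate X Xs Y Ys (dX : hom (Xs ⊗ X) 𝟙) (bX : hom 𝟙 (X ⊗ Xs))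
    (dY : hom (Ys ⊗ Y) 𝟙) (f : hom X Y) (g : hom Ys Xs) :
  duality dX bX -> (ldual bX dY f = g <-> dX ⊙ (g ⊠ X) = dY ⊙ (Ys ⊠ f)).
Proof.
move=> /dualityP [s1 s2]; split.
  move=> <-; rewrite sing_ldual; adistr; anorm.
  have := exch dY dX; anorm => E1; rewrite acompA -E1 -!acompA; congr (_ ⊙ _).
  have := exch (Ys ⊠ f) dX; anorm => E2; rewrite acompA -E2 -!acompA.
  awhisk Ys s1 (@unit M) => ->; by rewrite a1comp //=; anorm.
move=> e; apply: sing_inj; rewrite sing_ldual.
awhisk (@unit M) e Xs => F; rewrite acompA -F -acompA.
have := exch g bX; anorm => E; rewrite E acompA s2.
by rewrite acomp1.
Qed.

Lemma ldual_id X Xs (d : hom (Xs ⊗ X) 𝟙) (b : hom 𝟙 (X ⊗ Xs)) :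
  duality d b -> ldual b d (idm X) = idm Xs.
Proof. by move=> D; apply/(ldual_mate _ _ _ D). Qed.

Lemma ldual_comp X Xs Y Ys Z Zs (dX : hom (Xs ⊗ X) 𝟙) (bX : hom 𝟙 (X ⊗ Xs))
    (dY : hom (Ys ⊗ Y) 𝟙) (bY : hom 𝟙 (Y ⊗ Ys)) (dZ : hom (Zs ⊗ Z) 𝟙)
    (g : hom Y Z) (f : hom X Y) : duality dX bX -> duality dY bY ->
  ldual bX dZ (comp g f) = comp (ldual bX dY f) (ldual bY dZ g).
Proof.
move=> DX DY; apply/(ldual_mate _ _ _ DX); rewrite !sing_comp.
have /(ldual_mate _ _ _ DX) Ef := eq_refl (ldual bX dY f).
have /(ldual_mate _ _ _ DY) Eg := eq_refl (ldual bY dZ g).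
adistr; rewrite !acompA Ef -Eg -!acompA; congr (_ ⊙ _).
by have := exch (ldual bY dZ g) f; anorm => ->.
Qed.

Lemma sing_tens_ev X Xs Y Ys (dX : hom (Xs ⊗ X) 𝟙) (dY : hom (Ys ⊗ Y) 𝟙) :
  sing (tens_ev dX dY) = dY ⊙ (Ys ⊠ dX ⊠ Y).
Proof. by rewrite sing_cast sing_compc !sing_tens. Qed.

Lemma sing_tens_coev X Xs Y Ys (bX : hom 𝟙 (X ⊗ Xs)) (bY : hom 𝟙 (Y ⊗ Ys)) :
  sing (tens_coev bX bY) = (X ⊠ bY ⊠ Xs) ⊙ bX.
Proof. by rewrite sing_cast sing_compc !sing_tens. Qed.

Lemma ldual_tens X Xs Y Ys X' Xs' Y' Ys'
    (dX : hom (Xs ⊗ X) 𝟙) (bX : hom 𝟙 (X ⊗ Xs)) (dY : hom (Ys ⊗ Y) 𝟙)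
    (dX' : hom (Xs' ⊗ X') 𝟙) (bX' : hom 𝟙 (X' ⊗ Xs')) (dY' : hom (Ys' ⊗ Y') 𝟙)
    (f : hom X Y) (f' : hom X' Y') : duality dX bX -> duality dX' bX' ->
  ldual (tens_coev bX bX') (tens_ev dY dY') (f ⊗ f') =
  (ldual bX' dY' f' ⊗ ldual bX dY f)%hom.
Proof.
move=> DX DX'; apply/(ldual_mate _ _ _ (duality_tens DX DX')).
have /(ldual_mate _ _ _ DX) := eq_refl (ldual bX dY f).
have /(ldual_mate _ _ _ DX') := eq_refl (ldual bX' dY' f').
move: (ldual _ _ _) (ldual _ _ _) => g' g E' E.
rewrite !sing_tens_ev !sing_tens (atensE' g g') (atensE' f f') /=.
have := exch g ((dY ⊙ (Ys ⊠ f)) ⊠ X'); adistr; anorm => E1.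
have := exch dY f'; anorm => E2.
awhisk Xs' E X' => F.
awhisk Ys' E2 (@unit M) => {}E2.
awhisk (@unit M) E' (@unit M) => {}E'.
rewrite acompA -(acompA dX') F -(acompA dX') -E1.
by rewrite acompA E' !acompA -(acompA dY') -E2 !acompA.
Qed.

Lemma ldual_ev X Xs (d : hom (Xs ⊗ X) 𝟙) (b : hom 𝟙 (X ⊗ Xs))
    (ds : hom (X ⊗ Xs) 𝟙) (bs : hom 𝟙 (Xs ⊗ X)) :
  duality d b -> duality ds bs ->
  @ldual M _ _ 𝟙 𝟙 (tens_coev bs b) ⟦ idm (M := M) 𝟙 ⟧ d = bs.
Proof.
move=> D Ds; apply/(ldual_mate _ _ _ (duality_tens Ds D)).
move/dualityP: Ds => [s1 s2].
rewrite sing_tens_ev sing_cast !sing_id; anorm; rewrite acomp1 // -acompA.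
by awhisk (@unit M) s1 X => ->; rewrite a1comp.
Qed.

Lemma ldual_coev X Xs (d : hom (Xs ⊗ X) 𝟙) (b : hom 𝟙 (X ⊗ Xs))
    (ds : hom (X ⊗ Xs) 𝟙) :
  duality d b ->
  @ldual M 𝟙 𝟙 _ _ ⟦ idm (M := M) 𝟙 ⟧ (tens_ev d ds) b = ds.
Proof.
move=> D; apply/(ldual_mate _ _ _ duality1).
move/dualityP: D => [s1 s2].
rewrite sing_tens_ev sing_cast !sing_id; anorm; rewrite acomp1 // -acompA.
by awhisk X s2 (@unit M) => ->; rewrite a1comp.
Qed.

End Mates.

Section Braiding.
Variables (M : strict_moncat) (B : braiding M).
Implicit Types X Y Z : M.

Lemma psi1l X : sing (psi B 𝟙 X) = X.
Proof.
have [phi [i _]] := psi_iso B 𝟙 X.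
have e : sing (psi B 𝟙 X) = psi B 𝟙 X ⊙ psi B 𝟙 X.
  have := psi_tensl B 𝟙 𝟙 X; rewrite heq_sing sing_compc !sing_tens !sing_id.
  by rewrite a1tens atens1 => <-; rewrite (tens1o (𝟙 : M)).
have ii : phi ⊙ psi B 𝟙 X = X.
  by rewrite -sing_comp i sing_id tens1o.
by rewrite -[LHS](acomp1 (X := X)) /= ?tenso1 ?tens1o // -{1}ii -acompA -e.
Qed.

Lemma psi1r X : sing (psi B X 𝟙) = X.
Proof.
have [phi [i _]] := psi_iso B X 𝟙.
have e : sing (psi B X 𝟙) = psi B X 𝟙 ⊙ psi B X 𝟙.
  have := psi_tensr B X 𝟙 𝟙; rewrite heq_sing sing_compc !sing_tens !sing_id.
  by rewrite a1tens atens1 => <-; rewrite (tenso1 (𝟙 : M)).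
have ii : phi ⊙ psi B X 𝟙 = X.
  by rewrite -sing_comp i sing_id tenso1.
by rewrite -[LHS](acomp1 (X := X)) /= ?tenso1 ?tens1o // -{1}ii -acompA -e.
Qed.

Lemma sing_psi_nat X Y X' Y' (f : hom X Y) (g : hom X' Y') :
  psi B Y Y' ⊙ (f ⊠ g) = (g ⊠ f) ⊙ psi B X X'.
Proof.
have := congr1 (@sing M _ _) (psi_nat B f g).
by rewrite !sing_comp !sing_tens.
Qed.

Lemma sing_psi_tensl X Y Z :
  sing (psi B (X ⊗ Y) Z) = (psi B X Z ⊠ Y) ⊙ (X ⊠ psi B Y Z).
Proof. by have := psi_tensl B X Y Z; rewrite heq_sing sing_compc !sing_tens. Qed.

Lemma sing_psi_tensr X Y Z :
  sing (psi B X (Y ⊗ Z)) = (Y ⊠ psi B X Z) ⊙ (psi B X Y ⊠ Z).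
Proof. by have := psi_tensr B X Y Z; rewrite heq_sing sing_compc !sing_tens. Qed.

Lemma ldual_psi X Xs Y Ys (dX : hom (Xs ⊗ X) 𝟙) (bX : hom 𝟙 (X ⊗ Xs))
    (dY : hom (Ys ⊗ Y) 𝟙) (bY : hom 𝟙 (Y ⊗ Ys)) :
  duality dX bX -> duality dY bY ->
  ldual (tens_coev bX bY) (tens_ev dY dX) (psi B X Y) = psi B Xs Ys.
Proof.
move=> DX DY; apply/(ldual_mate _ _ _ (duality_tens DX DY)).
rewrite !sing_tens_ev.
have := sing_psi_nat dX (idm Ys).
rewrite psi1l sing_psi_tensl acomp1 /= ?tens1o // => N1.
have := sing_psi_nat (idm X) dY.
rewrite psi1r sing_psi_tensr acomp1 /= ?tenso1 // => N2.
have [phi [_ i]] := psi_iso B X Ys.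
have := congr1 (@sing M _ _) i; rewrite sing_comp => {}i.
awhisk Xs i Y => {}i.
awhisk (@unit M) N1 Y => {}N1.
awhisk Xs N2 (@unit M) => {}N2.
have := exch dX dY; anorm => E.
rewrite -[LHS](a1comp (X := (Xs ⊗ Ys ⊗ X ⊗ Y)%ob)) /= ?tensA //.
rewrite -[RHS](a1comp (X := (Xs ⊗ Ys ⊗ X ⊗ Y)%ob)) /= ?tensA //.
anorm.
rewrite -i !acompA; congr (_ ⊙ _).
by rewrite -!acompA; anorm; rewrite -N1 -N2 E.
Qed.

End Braiding.

Section PivotalObjects.
Variable M : strict_moncat.
Implicit Types X Y Z : pivotal_object M.

Lemma pivotal_object_eq X Y : po X = po Y -> pos X = pos Y ->
  pd X ≡ pd Y -> pb X ≡ pb Y -> pds X ≡ pds Y -> pbs X ≡ pbs Y -> X = Y.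
Proof.
case: X Y => [X Xs d b ds bs D Ds] [Y Ys d' b' ds' bs' D' Ds'] /= eX eXs.
destruct eX, eXs => /heq_eq e1 /heq_eq e2 /heq_eq e3 /heq_eq e4.
destruct e1, e2, e3, e4.
by congr PivotalObject; apply: proof_irrelevance.
Qed.

Definition piv1 : pivotal_object M :=
  @PivotalObject M 𝟙 𝟙 ⟦ idm (M := M) 𝟙 ⟧ ⟦ idm (M := M) 𝟙 ⟧ ⟦ idm (M := M) 𝟙 ⟧
    ⟦ idm (M := M) 𝟙 ⟧ (duality1 M) (duality1 M).

Definition pivtens X Y : pivotal_object M :=
  @PivotalObject M (po X ⊗ po Y) (pos Y ⊗ pos X)
    (tens_ev (pd X) (pd Y)) (tens_coev (pb X) (pb Y))
    (tens_ev (pds Y) (pds X)) (tens_coev (pbs Y) (pbs X))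
    (duality_tens (pd_pb_duality X) (pd_pb_duality Y))
    (duality_tens (pds_pbs_duality Y) (pds_pbs_duality X)).

Definition pivdual X : pivotal_object M :=
  @PivotalObject M (pos X) (po X) (pds X) (pbs X) (pd X) (pb X)
    (pds_pbs_duality X) (pd_pb_duality X).

Lemma pivotal_hom_eq X Y (f g : pivotal_hom X Y) : sval f = sval g -> f = g.
Proof.
case: f g => [f ef] [g eg] /= e; destruct e.
by congr exist; apply: proof_irrelevance.
Qed.

Lemma pivtensA X Y Z :
  pivtens X (pivtens Y Z) = pivtens (pivtens X Y) Z.
Proof.
have E (A As B Bs C Cs : M) (dA : hom (As ⊗ A) 𝟙) (dB : hom (Bs ⊗ B) 𝟙)
    (dC : hom (Cs ⊗ C) 𝟙) :
    tens_ev dA (tens_ev dB dC) ≡ tens_ev (tens_ev dA dB) dC.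
  by rewrite heq_sing !sing_tens_ev; adistr; anorm; rewrite !acompA.
have C (A As B Bs C Cs : M) (bA : hom 𝟙 (A ⊗ As)) (bB : hom 𝟙 (B ⊗ Bs))
    (bC : hom 𝟙 (C ⊗ Cs)) :
    tens_coev bA (tens_coev bB bC) ≡ tens_coev (tens_coev bA bB) bC.
  by rewrite heq_sing !sing_tens_coev; adistr; anorm; rewrite !acompA.
apply: pivotal_object_eq => //=; rewrite ?tensA //; exact/heq_sym.
Qed.

Lemma pivtens1o X : pivtens piv1 X = X.
Proof.
apply: pivotal_object_eq => /=; rewrite ?tens1o ?tenso1 ?heq_sing //.
- rewrite sing_tens_ev sing_cast sing_id; anorm; by rewrite a1comp.
- rewrite sing_tens_coev sing_cast sing_id; anorm; by rewrite a1comp.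
- rewrite sing_tens_ev sing_cast sing_id; anorm; by rewrite acomp1.
- rewrite sing_tens_coev sing_cast sing_id; anorm; by rewrite acomp1.
Qed.

Lemma pivtenso1 X : pivtens X piv1 = X.
Proof.
apply: pivotal_object_eq => /=; rewrite ?tens1o ?tenso1 ?heq_sing //.
- rewrite sing_tens_ev sing_cast sing_id; anorm; by rewrite acomp1.
- rewrite sing_tens_coev sing_cast sing_id; anorm; by rewrite acomp1.
- rewrite sing_tens_ev sing_cast sing_id; anorm; by rewrite a1comp.
- rewrite sing_tens_coev sing_cast sing_id; anorm; by rewrite a1comp.
Qed.

Lemma pstarstar_id X : idm (po X) = pstarstar (X := X) (Y := X) (idm (po X)).
Proof.
by rewrite /pstarstar /pstar !ldual_id //; case: X.
Qed.

Lemma pstar_comp X Y Z (g : hom (po Y) (po Z)) (f : hom (po X) (po Y)) :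
  pstar (X := X) (Y := Z) (comp g f) =
  comp (pstar (X := X) (Y := Y) f) (pstar (X := Y) (Y := Z) g).
Proof. exact: ldual_comp (pd_pb_duality X) (pd_pb_duality Y). Qed.

Lemma pstarstar_comp X Y Z (g : hom (po Y) (po Z)) (f : hom (po X) (po Y)) :
  pstarstar (X := X) (Y := Z) (comp g f) =
  comp (pstarstar (X := Y) (Y := Z) g) (pstarstar (X := X) (Y := Y) f).
Proof.
rewrite /pstarstar pstar_comp.
exact: ldual_comp (pds_pbs_duality Z) (pds_pbs_duality Y).
Qed.

Lemma pstar_tens X Y X' Y' (f : hom (po X) (po Y)) (g : hom (po X') (po Y')) :
  pstar (X := pivtens X X') (Y := pivtens Y Y') (f ⊗ g)%hom =
  (pstar (X := X') (Y := Y') g ⊗ pstar (X := X) (Y := Y) f)%hom.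
Proof. exact: ldual_tens (pd_pb_duality X) (pd_pb_duality X'). Qed.

Lemma pstarstar_tens X Y X' Y'
    (f : hom (po X) (po Y)) (g : hom (po X') (po Y')) :
  pstarstar (X := pivtens X X') (Y := pivtens Y Y') (f ⊗ g)%hom =
  (pstarstar (X := X) (Y := Y) f ⊗ pstarstar (X := X') (Y := Y') g)%hom.
Proof.
rewrite /pstarstar pstar_tens.
exact: ldual_tens (pds_pbs_duality Y') (pds_pbs_duality Y).
Qed.

Definition pivid X : pivotal_hom X X := exist _ (idm (po X)) (pstarstar_id X).

Lemma pivcomp_subproof X Y Z (g : pivotal_hom Y Z) (f : pivotal_hom X Y) :
  comp (sval g) (sval f) = pstarstar (comp (sval g) (sval f)).
Proof. by rewrite pstarstar_comp -(proj2_sig g) -(proj2_sig f). Qed.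

Definition pivcomp X Y Z (g : pivotal_hom Y Z) (f : pivotal_hom X Y) :
    pivotal_hom X Z :=
  exist _ (comp (sval g) (sval f)) (pivcomp_subproof g f).

Lemma pivtensm_subproof X Y X' Y' (f : pivotal_hom X Y) (g : pivotal_hom X' Y') :
  (sval f ⊗ sval g)%hom = pstarstar (X := pivtens X X') (Y := pivtens Y Y')
                            (sval f ⊗ sval g).
Proof. by rewrite pstarstar_tens -(proj2_sig g) -(proj2_sig f). Qed.

Definition pivtensm X Y X' Y' (f : pivotal_hom X Y) (g : pivotal_hom X' Y') :
    pivotal_hom (pivtens X X') (pivtens Y Y') :=
  exist _ (sval f ⊗ sval g)%hom (pivtensm_subproof f g).

Lemma pivheq X Y X' Y' (f : pivotal_hom X Y) (g : pivotal_hom X' Y') :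
  X = X' -> Y = Y' -> sval f ≡ sval g -> heq (hom := @pivotal_hom M) f g.
Proof.
move=> eX eY; destruct eX, eY => /heq_eq /pivotal_hom_eq ->; exact: heq_refl.
Qed.

Definition piv_moncat : strict_moncat.
Proof.
refine (@StrictMoncat (pivotal_object M) (@pivotal_hom M) pivid pivcomp
  piv1 pivtens pivtensm
  _ _ _ _ _ pivtensA pivtens1o pivtenso1 _ _ _).
- by move=> *; apply/pivotal_hom_eq/compA.
- by move=> *; apply/pivotal_hom_eq/comp1m.
- by move=> *; apply/pivotal_hom_eq/compm1.
- by move=> *; apply/pivotal_hom_eq/tensm_id.
- by move=> *; apply/pivotal_hom_eq/tensm_comp.
- by move=> *; apply: pivheq; rewrite ?pivtensA //; apply: tensmA.
- by move=> *; apply: pivheq; rewrite ?pivtens1o //; apply: tens1m.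
- by move=> *; apply: pivheq; rewrite ?pivtenso1 //; apply: tensm1.
Defined.

Lemma piv_heq (X Y X' Y' : piv_moncat) (f : hom X Y) (g : hom X' Y') :
  X = X' -> Y = Y' -> sing (sval f) = sing (sval g) -> f ≡ g.
Proof. by move=> eX eY /heq_sing; apply: pivheq. Qed.

Lemma sing_piv_cast (X Y X' Y' : piv_moncat) (f : hom X Y) (e : X = X')
  (e' : Y = Y') : sing (sval (castm f e e' : hom X' Y')) = sing (sval f).
Proof. by destruct e, e'. Qed.

Lemma sing_piv_compc (X Y Y' Z : piv_moncat) (g : hom Y' Z) (f : hom X Y)
    (e : Y = Y') :
  sing (sval (compc g f e : hom X Z)) = sing (sval g) ⊙ sing (sval f).
Proof. by destruct e; rewrite /compc /= sing_comp. Qed.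

Lemma sing_piv_tens (X Y X' Y' : piv_moncat) (f : hom X Y) (g : hom X' Y') :
  sing (sval (tensm f g)) = sing (sval f) ⊠ sing (sval g).
Proof. by rewrite -sing_tens. Qed.

Lemma pivev_subproof X :
  pd X = pstarstar (X := pivtens (pivdual X) X) (Y := piv1) (pd X).
Proof.
rewrite /pstarstar /pstar /=.
rewrite (ldual_ev (pd_pb_duality X) (pds_pbs_duality X)).
by rewrite (ldual_coev _ (pds_pbs_duality X)).
Qed.

Definition pivev X : pivotal_hom (pivtens (pivdual X) X) piv1 :=
  exist _ (pd X) (pivev_subproof X).

Lemma pivcoev_subproof X :
  pb X = pstarstar (X := piv1) (Y := pivtens X (pivdual X)) (pb X).
Proof.
rewrite /pstarstar /pstar /=.
rewrite (ldual_coev _ (pd_pb_duality X)).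
by rewrite (ldual_ev (pds_pbs_duality X) (pd_pb_duality X)).
Qed.

Definition pivcoev X : pivotal_hom piv1 (pivtens X (pivdual X)) :=
  exist _ (pb X) (pivcoev_subproof X).

Lemma piv_duality X : @duality piv_moncat X (pivdual X) (pivev X) (pivcoev X).
Proof.
have /dualityP [s1 s2] := pd_pb_duality X.
split; apply: piv_heq; rewrite ?tens1o ?tenso1 ?sing_piv_compc //.
  by rewrite !sing_piv_tens.
by rewrite !sing_piv_tens.
Qed.

Definition piv_duals : left_duals piv_moncat :=
  @LeftDuals piv_moncat pivdual pivev pivcoev piv_duality.

Lemma sval_dualm (X Y : piv_moncat) (f : hom X Y) :
  sval (dualm piv_duals f) = pstar (sval f).
Proof.
apply: sing_inj.
by rewrite sing_piv_cast !sing_piv_compc sing_ldual acompA !sing_piv_tens.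
Qed.

Lemma piv_strict_pivotal : strict_pivotal piv_duals.
Proof.
split=> //.
- move=> X; apply: pivotal_hom_eq; rewrite sval_dualm.
  exact: ldual_id (pd_pb_duality X).
- move=> X Y Z g f; apply: pivotal_hom_eq.
  by rewrite sval_dualm pstar_comp -!sval_dualm.
- move=> X Y X' Y' f g; apply: piv_heq => //; congr sing.
  by rewrite sval_dualm pstar_tens -!sval_dualm.
- by apply: piv_heq; rewrite ?sing_cast // [LHS]tens1o.
- by apply: piv_heq; rewrite ?sing_cast // [LHS]tens1o.
- move=> X Y; apply: piv_heq => //.
  by rewrite sing_piv_cast sing_piv_compc sing_tens_ev !sing_piv_tens.
- move=> X Y; apply: piv_heq => //.
  by rewrite sing_piv_cast sing_piv_compc sing_tens_coev !sing_piv_tens.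
- by case.
- move=> X Y f; apply: piv_heq; [by case: X {f}|by case: Y {f}|congr sing].
  by rewrite !sval_dualm; case: f.
Qed.

End PivotalObjects.

Section BraidedPivotalObjects.
Variable M : strict_braided_moncat.
Let B := braiding_of M.
Implicit Types X Y Z : pivotal_object M.

Lemma pivpsi_subproof X Y : psi B (po X) (po Y) =
  pstarstar (X := pivtens X Y) (Y := pivtens Y X) (psi B (po X) (po Y)).
Proof.
rewrite /pstarstar /pstar /=.
rewrite (ldual_psi B (pd_pb_duality X) (pd_pb_duality Y)).
by rewrite (ldual_psi B (pds_pbs_duality X) (pds_pbs_duality Y)).
Qed.

Definition pivpsi X Y : pivotal_hom (pivtens X Y) (pivtens Y X) :=
  exist _ (psi B (po X) (po Y)) (pivpsi_subproof X Y).

Definition piv_braiding : braiding (piv_moncat M).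
Proof.
refine (@Braiding (piv_moncat M) pivpsi _ _ _ _).
- move=> X Y; have [phi [i1 i2]] := psi_iso B (po X) (po Y).
  have e : phi = pstarstar (X := pivtens Y X) (Y := pivtens X Y) phi.
    have := pstarstar_comp (X := pivtens X Y) (Y := pivtens Y X)
      (Z := pivtens X Y) phi (psi B (po X) (po Y)).
    rewrite -pivpsi_subproof [X in pstarstar X]i1.
    rewrite -[LHS](pstarstar_id (pivtens X Y)) => E.
    have := congr1 (fun h => comp h phi) E.
    by rewrite /= comp1m -compA [X in comp _ X]i2 compm1.
  by exists (exist _ phi e); split; apply: pivotal_hom_eq.
- by move=> X Y X' Y' f g; apply/pivotal_hom_eq/psi_nat.
- move=> X Y Z; apply: piv_heq; rewrite ?tensA //.
  by rewrite sing_piv_compc !sing_piv_tens; apply: sing_psi_tensl.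
- move=> X Y Z; apply: piv_heq; rewrite ?tensA //.
  by rewrite sing_piv_compc !sing_piv_tens; apply: sing_psi_tensr.
Defined.

Definition pivcat : strict_braided_pivcat :=
  @StrictBraidedPivcat (StrictBraidedMoncat piv_braiding) (piv_duals M)
    (piv_strict_pivotal M).

End BraidedPivotalObjects.

Record braided_pivotal_subcategory (N : strict_braided_pivcat)
    (P : N -> Prop) : Prop := BraidedPivotalSubcategory {
  sub_unit : P 𝟙%ob;
  sub_tens : forall X Y : N, P X -> P Y -> P (X ⊗ Y)%ob;
  sub_dual : forall X : N, P X -> P (dual (duals_of N) X)
}.

(* The full subcategory of N on the objects satisfying P, with the structure
   restricted from N. *)
Section FullSubcategory.
Variables (N : strict_braided_pivcat) (P : N -> Prop).
Variable H : braided_pivotal_subcategory P.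
Let D := duals_of N.
Let B := braiding_of N.

Definition subob : Type := {X : N | P X}.
Definition subhom (X Y : subob) : Type := hom (sval X) (sval Y).
Implicit Types X Y Z : subob.

Lemma subob_eq X Y : sval X = sval Y -> X = Y.
Proof.
case: X Y => [X hX] [Y hY] /= e; destruct e.
by congr exist; apply: proof_irrelevance.
Qed.

Definition sub1 : subob := exist _ 𝟙%ob (sub_unit H).
Definition subtens X Y : subob :=
  exist _ (sval X ⊗ sval Y)%ob (sub_tens H (proj2_sig X) (proj2_sig Y)).
Definition subdual X : subob :=
  exist _ (dual D (sval X)) (sub_dual H (proj2_sig X)).

Lemma subtensA X Y Z : subtens X (subtens Y Z) = subtens (subtens X Y) Z.
Proof. by apply: subob_eq; rewrite /= tensA. Qed.
Lemma subtens1o X : subtens sub1 X = X.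
Proof. by apply: subob_eq; rewrite /= tens1o. Qed.
Lemma subtenso1 X : subtens X sub1 = X.
Proof. by apply: subob_eq; rewrite /= tenso1. Qed.

Lemma subheq X Y X' Y' (f : subhom X Y) (g : subhom X' Y') :
  X = X' -> Y = Y' -> heq (hom := @hom N) f g -> heq (hom := subhom) f g.
Proof. by move=> eX eY; destruct eX, eY => /heq_eq ->. Qed.

Definition sub_moncat : strict_moncat.
Proof.
refine (@StrictMoncat subob subhom (fun X => idm (sval X))
  (fun X Y Z (g : subhom Y Z) (f : subhom X Y) => comp g f) sub1 subtens
  (fun X Y X' Y' (f : subhom X Y) (g : subhom X' Y') => tensm f g)
  _ _ _ _ _ subtensA subtens1o subtenso1 _ _ _).
- by move=> *; apply: compA.
- by move=> *; apply: comp1m.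
- by move=> *; apply: compm1.
- by move=> *; apply: tensm_id.
- by move=> *; apply: tensm_comp.
- by move=> *; apply: subheq; rewrite ?subtensA //; apply: tensmA.
- by move=> *; apply: subheq; rewrite ?subtens1o //; apply: tens1m.
- by move=> *; apply: subheq; rewrite ?subtenso1 //; apply: tensm1.
Defined.

Definition subm (X Y : sub_moncat) (f : hom X Y) : hom (sval X) (sval Y) := f.

Lemma sub_heq (X Y X' Y' : sub_moncat) (f : hom X Y) (g : hom X' Y') :
  X = X' -> Y = Y' -> sing (subm f) = sing (subm g) -> f ≡ g.
Proof. by move=> eX eY /heq_sing; apply: subheq. Qed.

Lemma sing_sub_cast (X Y X' Y' : sub_moncat) (f : hom X Y) (e : X = X')
  (e' : Y = Y') : sing (subm (castm f e e')) = sing (subm f).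
Proof. by destruct e, e'. Qed.

Lemma sing_sub_compc (X Y Y' Z : sub_moncat) (g : hom Y' Z) (f : hom X Y)
    (e : Y = Y') :
  sing (subm (compc g f e)) = sing (subm g) ⊙ sing (subm f).
Proof. by destruct e; rewrite -sing_comp. Qed.

Lemma sing_sub_tens (X Y X' Y' : sub_moncat) (f : hom X Y) (g : hom X' Y') :
  sing (subm (tensm f g)) = sing (subm f) ⊠ sing (subm g).
Proof. by rewrite -sing_tens. Qed.

Definition sub_duals : left_duals sub_moncat.
Proof.
refine (@LeftDuals sub_moncat subdual (fun X => ev D (sval X))
  (fun X => coev D (sval X)) _) => X.
have /dualityP [s1 s2] := ev_coev_duality D (sval X).
by split; apply: sub_heq; rewrite ?tens1o ?tenso1 // sing_sub_compc
  !sing_sub_tens.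
Defined.

Lemma subm_dualm (X Y : sub_moncat) (f : hom X Y) :
  subm (dualm sub_duals f) = dualm D (subm f).
Proof.
apply: sing_inj.
by rewrite sing_sub_cast !sing_sub_compc sing_ldual acompA !sing_sub_tens.
Qed.

Lemma sub_strict_pivotal : strict_pivotal sub_duals.
Proof.
have S := pivotal_of N; split.
- by move=> X; rewrite -[LHS]/(subm _) subm_dualm; exact: dualm_id S _.
- move=> X Y Z g f; rewrite -[LHS]/(subm _) subm_dualm.
  rewrite -[RHS]/(comp (subm (dualm sub_duals f)) (subm (dualm sub_duals g))).
  by rewrite !subm_dualm -(dualm_comp S).
- by apply: subob_eq; exact: dual_unit S.
- by move=> X Y; apply: subob_eq; exact: dual_tens S _ _.
- move=> X Y X' Y' f g; apply: sub_heq; try exact/subob_eq/(dual_tens S).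
  rewrite sing_sub_tens !subm_dualm -sing_tens; apply/heq_sing.
  exact: (dualm_tens S (subm f) (subm g)).
- apply: sub_heq => //; last exact/heq_sing/(ev_unit S).
  by apply: subob_eq; rewrite /= (dual_unit S) tens1o.
- apply: sub_heq => //; last exact/heq_sing/(coev_unit S).
  by apply: subob_eq; rewrite /= (dual_unit S) tens1o.
- move=> X Y; apply: sub_heq => //; first by apply: subob_eq; rewrite /= (dual_tens S).
  rewrite sing_sub_cast sing_sub_compc !sing_sub_tens -sing_tens_ev.
  exact/heq_sing/(ev_tens S).
- move=> X Y; apply: sub_heq => //; first by apply: subob_eq; rewrite /= (dual_tens S).
  rewrite sing_sub_cast sing_sub_compc !sing_sub_tens -sing_tens_coev.
  exact/heq_sing/(coev_tens S).
- by move=> X; apply: subob_eq; exact: dualK S _.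
- move=> X Y f; apply: sub_heq; try exact/subob_eq/(dualK S).
  by rewrite !subm_dualm; apply/heq_sing/(dualmK S).
Qed.

Definition sub_braiding : braiding sub_moncat.
Proof.
refine (@Braiding sub_moncat (fun X Y => psi B (sval X) (sval Y)) _ _ _ _).
- by move=> X Y; exact: psi_iso B (sval X) (sval Y).
- by move=> X Y X' Y' f g; exact: (psi_nat B (subm f) (subm g)).
- move=> X Y Z; apply: sub_heq; rewrite ?tensA //.
  by rewrite sing_sub_compc !sing_sub_tens; exact: sing_psi_tensl B _ _ _.
- move=> X Y Z; apply: sub_heq; rewrite ?tensA //.
  by rewrite sing_sub_compc !sing_sub_tens; exact: sing_psi_tensr B _ _ _.
Defined.

Definition full_subcategory : strict_braided_pivcat :=
  @StrictBraidedPivcat (StrictBraidedMoncat sub_braiding) sub_duals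
    sub_strict_pivotal.

End FullSubcategory.

(* Main.v *)
(** For any duality the left dual of the left curl of X is the right curl of
    X^*, and vice versa: the rotation of ψ_{X,X} is ψ_{X^*,X^*}, and the strand
    closed on one side of X is closed on the other side of X^*. Hence equality
    of the curls passes to X^*. For a tensor product, the hexagon laws,
    Yang-Baxter and naturality pull the two loops apart: both curls satisfy
    c_{X⊗Y} = ψ_{Y,X} ψ_{X,Y} (c_X ⊗ c_Y), so equality of the curls passes to
    X ⊗ Y. *)

From mathcomp Require Import ssreflect ssrfun.
Require Import Defs.

Set Implicit Arguments.
Unset Strict Implicit.
Unset Printing Implicit Defensive.

(** * Local rewriting inside right-associated composites *)

Section Reassociation.
Variable M : strict_moncat.
Implicit Types f g h k r : arr M.

Lemma acompA2 g f r : g ⊙ f = r -> forall k, g ⊙ (f ⊙ k) = r ⊙ k.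
Proof. by move=> <- k; rewrite acompA. Qed.

Lemma acompA3 h g f r : h ⊙ (g ⊙ f) = r -> forall k, h ⊙ (g ⊙ (f ⊙ k)) = r ⊙ k.
Proof. by move=> <- k; rewrite !acompA. Qed.

End Reassociation.

(** * Curls of duals and of tensor products *)

Section Curls.
Variable M : strict_braided_moncat.
Let B := braiding_of M.
Implicit Types X Y Z : M.

Lemma sing_curlR X Xs (ds : hom (X ⊗ Xs) 𝟙) (b : hom 𝟙 (X ⊗ Xs)) :
  sing (curlR ds b) = (X ⊠ ds) ⊙ ((psi B X X ⊠ Xs) ⊙ (X ⊠ b)).
Proof. by rewrite sing_cast !sing_compc !sing_tens acompA. Qed.

Lemma sing_curlL X Xs (d : hom (Xs ⊗ X) 𝟙) (bs : hom 𝟙 (Xs ⊗ X)) :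
  sing (curlL d bs) = (d ⊠ X) ⊙ ((Xs ⊠ psi B X X) ⊙ (bs ⊠ X)).
Proof. by rewrite sing_cast !sing_compc !sing_tens acompA. Qed.

(** Naturality of the braiding of X ⊗ Y with Z along [psi B X Y], expanded by the hexagon law. *)
Lemma psi_yang_baxter X Y Z :
  (Z ⊠ psi B X Y) ⊙ ((psi B X Z ⊠ Y) ⊙ (X ⊠ psi B Y Z)) =
  (psi B Y Z ⊠ X) ⊙ ((Y ⊠ psi B X Z) ⊙ (psi B X Y ⊠ Z)).
Proof.
rewrite -sing_psi_tensl acompA.
have := sing_psi_nat B (psi B X Y) (idm Z).
by rewrite !sing_psi_tensl !acompA => <-.
Qed.

Lemma psi_evs X Xs (d : hom (Xs ⊗ X) 𝟙) (b : hom 𝟙 (X ⊗ Xs)) : duality d b ->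
  d ⊙ ((Xs ⊠ d ⊠ X) ⊙ (psi B Xs Xs ⊠ (X ⊗ X)%ob)) =
  d ⊙ ((Xs ⊠ d ⊠ X) ⊙ ((Xs ⊗ Xs)%ob ⊠ psi B X X)).
Proof.
move=> D; have := ldual_psi B D D.
by move/(ldual_mate _ _ _ (duality_tens D D)); rewrite !sing_tens_ev -!acompA.
Qed.

(** Paired with [d], both curls become the nested evaluation with [bs] inserted in the middle, and
    [psi_evs] moves the crossing across. *)
Lemma ldual_curlL X Xs (d : hom (Xs ⊗ X) 𝟙) (b : hom 𝟙 (X ⊗ Xs))
    (bs : hom 𝟙 (Xs ⊗ X)) :
  duality d b -> ldual b d (curlL d bs) = curlR d bs.
Proof.
move=> D; apply/(ldual_mate _ _ _ D); rewrite sing_curlL sing_curlR.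
have E := psi_evs D.
by adistr; anorm; rewrite !acompA -(acompA d) E -!acompA.
Qed.

Lemma ldual_curlR X Xs (d : hom (Xs ⊗ X) 𝟙) (b : hom 𝟙 (X ⊗ Xs))
    (ds : hom (X ⊗ Xs) 𝟙) :
  duality d b -> ldual b d (curlR ds b) = curlL ds b.
Proof.
move=> D; apply/(ldual_mate _ _ _ D); rewrite sing_curlL sing_curlR.
have E := psi_evs D; have /dualityP [s1 s2] := D.
(* Bending the input X^* of d to the left exposes the nested evaluation of
   X ⊗ X, across which the braiding rotates. *)
have F : d ⊠ X = (X ⊠ d) ⊙ (((X ⊗ Xs)%ob ⊠ d ⊠ X) ⊙ (b ⊠ (Xs ⊗ X ⊗ X)%ob)).
  have := exch b (d ⊠ X); anorm => <-.
  by rewrite acompA s1 acomp1 //=; anorm.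
have S1 := exch d ds; move: S1; anorm => S1.
have S2 := exch b (Xs ⊠ psi B X X ⊠ Xs); move: S2; anorm => S2.
have S3 := exch b ((Xs ⊗ X)%ob ⊠ b); move: S3; anorm => S3.
have S4 := exch d b; move: S4; anorm => S4.
awhisk (@unit M) F Xs => {}F.
awhisk X E Xs => {}E.
awhisk (X ⊗ Xs)%ob S4 (@unit M) => {}S4.
awhisk X s2 (@unit M) => {}s2.
adistr; anorm.
have S5 := exch (X ⊠ psi B Xs Xs ⊠ X) b; move: S5; anorm => S5.
have S6 := exch ds d; move: S6; anorm => S6.
(* The [b] created by the bending slides to the bottom, [psi_evs] trades ψ_{X,X} for ψ_{X^*,X^*},
   and the second zigzag identity cancels the outer evaluation against the original [b] of the
   curl. *)
rewrite (acompA2 S1) F -!acompA (acompA2 S2) -!acompA S3 (acompA3 (esym E)) -!acompA.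
rewrite (acompA2 S5) -!acompA (acompA2 S4) -!acompA (acompA2 s2) acomp1; last aside.
by rewrite [RHS](acompA2 S6) -acompA.
Qed.

Lemma curlR_tens X Xs Y Ys (dsX : hom (X ⊗ Xs) 𝟙) (bX : hom 𝟙 (X ⊗ Xs))
    (dsY : hom (Y ⊗ Ys) 𝟙) (bY : hom 𝟙 (Y ⊗ Ys)) :
  sing (curlR (tens_ev dsY dsX) (tens_coev bX bY)) =
  psi B Y X ⊙ psi B X Y ⊙ (curlR dsX bX ⊠ curlR dsY bY).
Proof.
have EX := sing_curlR dsX bX; have EY := sing_curlR dsY bY.
rewrite sing_curlR sing_tens_ev sing_tens_coev sing_psi_tensl !sing_psi_tensr.
move: (curlR dsX bX) (curlR dsY bY) EX EY => rX rY EX EY.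
have NY := sing_psi_nat B rY (idm X).
have NX := sing_psi_nat B rX (idm Y); rewrite sing_id in NX.
have YB := psi_yang_baxter X Y X.
have T1 := exch (X ⊠ psi B X Y) (dsY ⊠ Xs); move: T1; anorm => T1.
have T2 := exch (psi B X X) (Y ⊠ dsY ⊠ Xs); move: T2; anorm => T2.
have T3 := exch (X ⊠ psi B Y X) (bY ⊠ Xs); move: T3; anorm => T3.
have T4 := exch (psi B Y X) dsX; move: T4; anorm => T4.
have T5 := exch (X ⊠ rY) bX; move: T5; anorm => T5.
have T6 := exch (psi B X Y) bX; move: T6; anorm => T6.
awhisk (X ⊗ X)%ob EY Xs => {}EY.
awhisk Y EX (@unit M) => {}EX.
awhisk X NY Xs => {}NY.
awhisk (@unit M) YB Xs => {}YB.
rewrite (atensE rX rY).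
adistr; anorm; rewrite -!acompA.
(* The Y-loop is the inner one: [dsY] and [bY] slide to ψ_{Y,Y}, the loop contracts to [rY], and
   [rY] leaves through ψ_{Y,X}. *)
rewrite (acompA2 (esym T1)) -!acompA (acompA2 (esym T2)) -!acompA (acompA2 T3).
rewrite -!acompA (acompA3 (esym EY)) (acompA2 (esym NY)) -!acompA T5.
(* Yang-Baxter carries the remaining Y-strand across ψ_{X,X}, so that the X-loop can contract as
   well. *)
rewrite (acompA3 YB) -!acompA (acompA2 T6) -!acompA (acompA2 (esym T4)).
by rewrite -!acompA (acompA3 (esym EX)) (acompA2 (esym NX)) -!acompA.
Qed.

Lemma curlL_tens X Xs Y Ys (dX : hom (Xs ⊗ X) 𝟙) (bsX : hom 𝟙 (Xs ⊗ X))
    (dY : hom (Ys ⊗ Y) 𝟙) (bsY : hom 𝟙 (Ys ⊗ Y)) :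
  sing (curlL (tens_ev dX dY) (tens_coev bsY bsX)) =
  psi B Y X ⊙ psi B X Y ⊙ (curlL dX bsX ⊠ curlL dY bsY).
Proof.
have EX := sing_curlL dX bsX; have EY := sing_curlL dY bsY.
rewrite sing_curlL sing_tens_ev sing_tens_coev sing_psi_tensr !sing_psi_tensl.
move: (curlL dX bsX) (curlL dY bsY) EX EY => rX rY EX EY.
have NX := sing_psi_nat B (idm Y) rX.
have NY := sing_psi_nat B (idm X) rY; rewrite sing_id in NY.
have YB := psi_yang_baxter Y X Y.
have T1 := exch (Ys ⊠ dX) (psi B X Y ⊠ Y); move: T1; anorm => T1.
have T2 := exch (Ys ⊠ dX ⊠ X) (psi B Y Y); move: T2; anorm => T2.
have T3 := exch (Ys ⊠ bsX) (psi B Y X ⊠ Y); move: T3; anorm => T3.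
have T4 := exch dY (psi B Y X); move: T4; anorm => T4.
have T5 := exch bsY (rX ⊠ Y); move: T5; anorm => T5.
have T6 := exch bsY (psi B X Y); move: T6; anorm => T6.
awhisk Ys EX (Y ⊗ Y)%ob => {}EX.
awhisk (@unit M) EY X => {}EY.
awhisk Ys NX Y => {}NX.
awhisk Ys YB (@unit M) => {}YB.
rewrite (atensE' rX rY).
adistr; anorm; rewrite -!acompA.
(* Mirror image of the right curl: now the X-loop is the inner one and contracts first. *)
rewrite (acompA2 T1) -!acompA (acompA2 T2) -!acompA (acompA2 (esym T3)).
rewrite -!acompA (acompA3 (esym EX)) (acompA2 (esym NX)) -!acompA -T5.
rewrite (acompA3 (esym YB)) -!acompA (acompA2 (esym T6)) -!acompA (acompA2 T4).
by rewrite -!acompA (acompA3 (esym EY)) (acompA2 (esym NY)) -!acompA.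
Qed.

End Curls.

(** * Closure of ribbon objects, and curls in the category of pivotal objects *)

Section RibbonObjects.
Variable M : strict_braided_moncat.
Implicit Types X Y : pivotal_object M.

Lemma ribbon_piv1 : ribbon_object (piv1 M).
Proof.
apply: sing_inj; rewrite sing_curlR sing_curlL !sing_cast psi1l.
by rewrite sing_id; anorm.
Qed.

Lemma ribbon_pivtens X Y :
  ribbon_object X -> ribbon_object Y -> ribbon_object (pivtens X Y).
Proof.
move=> rX rY; apply: sing_inj; rewrite curlR_tens curlL_tens.
by rewrite /ribbon_object in rX rY; rewrite rX rY.
Qed.

Lemma ribbon_pivdual X : ribbon_object X -> ribbon_object (pivdual X).
Proof.
move=> rX; have D := pd_pb_duality X; rewrite /ribbon_object /=.
by rewrite -(ldual_curlL _ D) -(ldual_curlR _ D) rX.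
Qed.

Lemma ribbon_subcategory :
  braided_pivotal_subcategory (N := pivcat M) (@ribbon_object M).
Proof.
by split; [exact: ribbon_piv1|exact: ribbon_pivtens|exact: ribbon_pivdual].
Qed.

Lemma sval_castm (X Y X' Y' : pivcat M) (f : hom X Y) (eX : X = X')
    (eY : Y = Y') (g : hom (po X') (po Y')) :
  sing (sval f) = sing g -> sval (@castm (pivcat M) X Y X' Y' f eX eY) = g.
Proof. by destruct eX, eY => /sing_inj. Qed.

Lemma sval_curlR X Xs (ds : @hom (pivcat M) (pivtens X Xs) (piv1 M))
    (b : @hom (pivcat M) (piv1 M) (pivtens X Xs)) :
  sval (@curlR (pivcat M) X Xs ds b) = @curlR M (po X) (po Xs) (sval ds) (sval b).
Proof.
apply: sing_inj; rewrite sing_curlR.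
by rewrite sing_piv_cast !sing_piv_compc !sing_piv_tens -acompA.
Qed.

Lemma sval_curlL X Xs (d : @hom (pivcat M) (pivtens Xs X) (piv1 M))
    (bs : @hom (pivcat M) (piv1 M) (pivtens Xs X)) :
  sval (@curlL (pivcat M) X Xs d bs) = @curlL M (po X) (po Xs) (sval d) (sval bs).
Proof.
apply: sing_inj; rewrite sing_curlL.
by rewrite sing_piv_cast !sing_piv_compc !sing_piv_tens -acompA.
Qed.

End RibbonObjects.

(** * Curls in a full subcategory *)

Section FullSubcategoryCurls.
Variables (N : strict_braided_pivcat) (P : N -> Prop).
Variable H : braided_pivotal_subcategory P.

(** Restriction keeps all structure morphisms, so the curls agree up to transport. *)
Lemma sub_ribbon : (forall X : N, P X -> let D := duals_of N in
    curlR ⟦ ev D (dual D X) ⟧ (coev D X) = curlL (ev D X) ⟦ coev D (dual D X) ⟧) ->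
  strict_ribbon (full_subcategory H).
Proof.
move=> r X /=; have := r _ (proj2_sig X) => /(congr1 (@sing _ _ _)).
rewrite sing_curlR sing_curlL !sing_cast => E.
apply: (@sing_inj N).
rewrite -[X in sing X = _]/(subm _) -[X in _ = sing X]/(subm _).
rewrite !sing_sub_cast !sing_sub_compc !sing_sub_tens !sing_sub_cast.
by rewrite -!acompA.
Qed.

End FullSubcategoryCurls.

Theorem proposition3p4 (M : strict_braided_moncat) :
  exists H : braided_pivotal_subcategory (N := pivcat M) (@ribbon_object M),
    strict_ribbon (full_subcategory H).
Proof.
exists (ribbon_subcategory M); apply: sub_ribbon => X rX D.
apply: pivotal_hom_eq; rewrite sval_curlR sval_curlL.
(* The chosen (co)evaluation of X^* has underlying morphism [pds X] (resp. [pbs X]), up to the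
   transport along X^{**} = X. *)
apply: etrans (etrans rX _); [congr curlR|congr curlL; symmetry].
  exact: (@sval_castm M _ _ (pivtens X (pivdual X)) (piv1 M)).
exact: (@sval_castm M _ _ (piv1 M) (pivtens (pivdual X) X)).
Qed.
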